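(* Assume the standing setting and assumption in the context. There exists a constant $C>0$ such that for any $\epsilon\ge0$ there exists $N\in\mathbb N$ such that for all $x\in\mathbb Z^d$ with $|x|_1\ge N$, $$\mathbb E\big[\nu_x[r,r+\epsilon]\big]\ \ge\ C\,\mu[r,r+\epsilon].$$
   Context: Setting: $d\ge2$; $\mathcal E^d$ nearest-neighbor edges of $\mathbb Z^d$; $\{\tau_e\}$ i.i.d. non-negative with law $\mu$, distribution function $F$, essential infimum $r$. Standing assumption: $F(r)<p_c(d)$ if $r=0$ and $F(r)<\vec p_c(d)$ if $r>0$ ($p_c(d)$, $\vec p_c(d)$: critical probabilities of Bernoulli bond and oriented bond percolation on $\mathbb Z^d$). $T(\gamma)=\sum_{e\in\gamma}\tau_e$; geodesics from $x$ to $y$ are vertex self-avoiding paths minimizing $T$. Fix a deterministic ordering of all finite vertex self-avoiding paths; $\pi^{(x)}$ is the first geodesic from $0$ to $x$ in it. $\nu_x(B)=\frac{1}{|\pi^{(x)}|}\#\{e\in\pi^{(x)}:\tau_e\in B\}$. *)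

(* Defs.v *)
From HB Require Import structures.
From mathcomp Require Import all_boot all_order all_algebra.
From mathcomp Require Import all_classical all_reals all_analysis.
Set Implicit Arguments. Unset Strict Implicit. Unset Printing Implicit Defensive.
Import Order.TTheory GRing.Theory Num.Theory.
Local Open Scope classical_set_scope.
Local Open Scope ring_scope.

Definition V (d : nat) := 'rV[int]_d.

Definition unitv (d : nat) (i : 'I_d) : V d := delta_mx 0 i.

Definition l1 (d : nat) (x : V d) : nat := (\sum_(i < d) absz (x ord0 i))%N.

(* an undirected nearest-neighbour edge {x, x + e_i} is represented
   (uniquely) by the pair (x, i) *)
Definition E (d : nat) := (V d * 'I_d)%type.

Definition adj (d : nat) (u v : V d) : bool :=
  [exists i : 'I_d, (v == u + unitv i) || (u == v + unitv i)].

Definition edge_of (d : nat) (u v : V d) : option (E d) :=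
  match [pick i : 'I_d | v == u + unitv i] with
  | Some i => Some (u, i)
  | None => match [pick i : 'I_d | u == v + unitv i] with
            | Some i => Some (v, i)
            | None => None
            end
  end.

Definition nn_path (d : nat) (x y : V d) (s : seq (V d)) : Prop :=
  [/\ s != [::], head x s = x, last x s = y & path (@adj d) x (behead s)].

Definition sa_path (d : nat) (x y : V d) (s : seq (V d)) : Prop :=
  nn_path x y s /\ uniq s.

Definition edges (d : nat) (s : seq (V d)) : seq (E d) :=
  pmap (fun uv => edge_of uv.1 uv.2) (zip s (behead s)).

Definition indep_events (R : realType) (dT : measure_display)
  (T : measurableType dT) (P : probability T R) (I : eqType)
  (A : I -> set T) : Prop :=
  forall s : seq I, uniq s ->
    P [set w | forall i, i \in s -> A i w] = (\prod_(i <- s) P (A i))%E.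

Definition indep_RVs (R : realType) (dT : measure_display)
  (T : measurableType dT) (P : probability T R) (I : eqType)
  (X : I -> T -> R) : Prop :=
  forall B : I -> set R, (forall i, measurable (B i)) ->
    indep_events P (fun i => X i @^-1` B i).

(* w is an i.i.d. Bernoulli(p) family of edge states (true = open) *)
Definition bernoulli_bond (R : realType) (dT : measure_display)
  (T : measurableType dT) (P : probability T R) (d : nat) (p : R)
  (w : E d -> T -> bool) : Prop :=
  [/\ forall e, measurable [set om | w e om],
      indep_events P (fun e => [set om | w e om]) &
      forall e, P [set om | w e om] = p%:E].

Definition perc_event (d : nat) (T : Type) (w : E d -> T -> bool) : set T :=
  [set om | ~ finite_set [set v : V d | exists s, nn_path 0 v s /\
      forall e, e \in edges s -> w e om]].

Definition oriented_path (d : nat) (x y : V d) (s : seq (V d)) : Prop :=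
  [/\ s != [::], head x s = x, last x s = y &
      path (fun u v => [exists i : 'I_d, v == u + unitv i]) x (behead s)].

Definition operc_event (d : nat) (T : Type) (w : E d -> T -> bool) : set T :=
  [set om | ~ finite_set [set v : V d | exists s, oriented_path 0 v s /\
      forall e, e \in edges s -> w e om]].

Definition p_c (R : realType) (d : nat) : R :=
  sup [set p : R | 0 <= p <= 1 /\
    forall (dT : measure_display) (T : measurableType dT)
      (P : probability T R) (w : E d -> T -> bool),
      bernoulli_bond P p w -> P (perc_event w) = 0%E].

Definition vec_p_c (R : realType) (d : nat) : R :=
  sup [set p : R | 0 <= p <= 1 /\
    forall (dT : measure_display) (T : measurableType dT)
      (P : probability T R) (w : E d -> T -> bool),
      bernoulli_bond P p w -> P (operc_event w) = 0%E].

Definition distF (R : realType) (mu : probability R R) (a : R) : R :=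
  fine (mu [set` `]-oo, a]]).

Definition ess_inf (R : realType) (mu : probability R R) : R :=
  inf [set a : R | 0 < distF mu a].

Definition passage (R : realType) (d : nat) (T : Type) (tau : E d -> T -> R)
  (om : T) (s : seq (V d)) : R := \sum_(e <- edges s) tau e om.

Definition geodesic (R : realType) (d : nat) (T : Type) (tau : E d -> T -> R)
  (om : T) (x : V d) (s : seq (V d)) : Prop :=
  sa_path 0 x s /\
  forall s', sa_path 0 x s' -> passage tau om s <= passage tau om s'.

Definition first_geodesic (R : realType) (d : nat) (T : Type)
  (rk : seq (V d) -> nat) (tau : E d -> T -> R) (om : T) (x : V d)
  (s : seq (V d)) : Prop :=
  geodesic tau om x s /\ forall s', geodesic tau om x s' -> (rk s <= rk s')%N.

(* nu_x([a,b]) = #{e in pi^(x) : tau_e in [a,b]} / |pi^(x)|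
   (set to 0 on the null event where no geodesic exists) *)
Definition nu (R : realType) (d : nat) (T : Type)
  (rk : seq (V d) -> nat) (tau : E d -> T -> R) (x : V d) (a b : R)
  (om : T) : R :=
  xget 0 [set v : R | exists s, first_geodesic rk tau om x s /\
    v = (count (fun e => a <= tau e om <= b) (edges s))%:R
        / (size (edges s))%:R].

(* Main.v *)
(* One can take C = 1 and N = 1. Fix a path s and an edge e of s. The event G that s
   is the first geodesic is decreasing in tau_e, because lowering tau_e lowers all
   paths through e by the same amount. Hence, by Chebyshev's association inequality
   and the independence of tau_e from the other weights,
   P(G, tau_e in [r, r + eps]) >= P(G) mu[r, r + eps]. Dividing by the length of s and
   summing over e in s, then over s, bounds E[nu_x[r, r + eps]] below by
   mu[r, r + eps] times the probability that a geodesic exists.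

   This probability is 1: for some delta > 0 all clusters of edges with
   tau_e <= delta are almost surely finite, so the paths from 0 of passage time at
   most M stay in a finite set. If r > 0, take delta = r / 2. If r = 0, take delta with
   F(delta) < p_c and couple the edges with tau_e <= delta, on T x [0, 1], with
   Bernoulli percolation at some p > F(delta) for which all clusters are finite. *)
Require Import Defs.
From HB Require Import structures.
From mathcomp Require Import all_boot all_order all_algebra.
From mathcomp Require Import all_classical all_reals all_analysis.
From mathcomp Require Import measurable_realfun lra ring.
Set Implicit Arguments. Unset Strict Implicit. Unset Printing Implicit Defensive.
Import Order.TTheory GRing.Theory Num.Theory.
Local Open Scope classical_set_scope.
Local Open Scope ring_scope.

(** * Edges and nearest-neighbour paths of the lattice *)

Lemma edge_of_endpoints d (u v : V d) e : edge_of u v = Some e ->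
  (u = e.1 /\ v = e.1 + unitv e.2) \/ (v = e.1 /\ u = e.1 + unitv e.2).
Proof.
rewrite /edge_of; case: pickP => [i /eqP -> [<-]|_]; first by left.
by case: pickP => // i /eqP -> [<-]; right.
Qed.

Lemma edge_of_adj d (u v : V d) : adj u v -> exists e, edge_of u v = Some e.
Proof.
case/existsP => i; rewrite /edge_of.
case: pickP => [j _ _|H]; first by exists (u, j).
rewrite H /= => uv; case: pickP => [j _|/(_ i)]; first by exists (v, j).
by rewrite uv.
Qed.

Lemma edges_cons d (u v : V d) s : edges [:: u, v & s] =
  if edge_of u v is Some e then e :: edges (v :: s) else edges (v :: s).
Proof. by rewrite /edges /=; case: edge_of. Qed.

Lemma size_edges d (u : V d) p : path (@adj d) u p ->
  size (edges (u :: p)) = size p.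
Proof.
elim: p u => [|v p IH] u //= /andP [uv vp].
by rewrite edges_cons; have [e ->] := edge_of_adj uv; rewrite /= IH.
Qed.

Lemma edges_endpoints d (s : seq (V d)) e : e \in edges s ->
  e.1 \in s /\ e.1 + unitv e.2 \in s.
Proof.
elim: s => [//|u [//|v s] IH]; rewrite edges_cons.
have H : e \in edges (v :: s) -> e.1 \in [:: u, v & s] /\
    e.1 + unitv e.2 \in [:: u, v & s].
  by move=> /IH [h1 h2]; rewrite [_ \in u :: _]in_cons h1 [_ \in u :: _]in_cons h2 !orbT.
case E1: edge_of => [e'|]; last exact: H.
rewrite inE => /orP [/eqP ->|]; last exact: H.
by case: (edge_of_endpoints E1) => [] [<- <-]; rewrite !inE !eqxx ?orbT.
Qed.

(** The first vertex is an endpoint of the first edge and does not recur, so no later edge can equal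
    the first one. *)
Lemma uniq_edges d (s : seq (V d)) : uniq s -> uniq (edges s).
Proof.
elim: s => [//|u [//|v s] IH] /andP [us /IH vs]; rewrite edges_cons.
case E1: edge_of => [e|] //=; rewrite vs andbT.
apply/negP => /edges_endpoints [h1 h2]; case/negP: us.
by case: (edge_of_endpoints E1) => [] [h h']; [rewrite h|rewrite h'].
Qed.

Lemma edges_cat d (v : V d) p1 p2 :
  edges (v :: p1 ++ p2) = edges (v :: p1) ++ edges (last v p1 :: p2).
Proof.
elim: p1 v => [//|y p1 IH] v /=.
by rewrite !edges_cons IH; case: edge_of.
Qed.

Lemma nn_pathP d (v u : V d) s : nn_path v u s <->
  exists p, [/\ s = v :: p, last v p = u & path (@adj d) v p].
Proof.
split=> [|[p [-> <- vp]]]; last by split.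
by case: s => [[]//|y p] [_ /= -> <- vp]; exists p.
Qed.

(** Induction on [l1 x]: moving a non-zero coordinate one unit towards 0 gives a neighbour of
    smaller norm. *)
Lemma nn_path_to d (x : V d) : exists p, path (@adj d) 0 p /\ last 0 p = x.
Proof.
have step (y z : V d) : adj y z ->
    (exists p, path (@adj d) 0 p /\ last 0 p = y) ->
    exists p, path (@adj d) 0 p /\ last 0 p = z.
  move=> yz [p [vp lp]]; exists (rcons p z).
  by rewrite rcons_path vp lp last_rcons.
have [n] := ubnP (l1 x); elim: n x => // n IH x ltx.
have [->|x0] := eqVneq x 0; first by exists [::].
have [i xi] : exists i, x ord0 i != 0.
  apply/existsP; rewrite -negb_forall; apply: contra x0 => /forallP x0.
  by apply/eqP/matrixP => i j; rewrite (ord1 i) mxE; exact/eqP.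
have l1D (y : V d) : (absz (y ord0 i) < absz (x ord0 i))%N ->
    (forall j, j != i -> y ord0 j = x ord0 j) -> (l1 y < n)%N.
  move=> yi yj; rewrite -ltnS; apply: leq_trans ltx.
  rewrite ltnS /l1 (bigD1 i) // [ltnRHS](bigD1 i) //=.
  rewrite (eq_bigr (fun j => absz (x ord0 j))) ?ltn_add2r // => j ji.
  by rewrite yj.
have [xpos|xneg] := ltP 0 (x ord0 i).
- apply: (step (x - unitv i)); first by apply/existsP; exists i; rewrite subrK eqxx.
  apply/IH/l1D => [|j ji]; rewrite !mxE ?eqxx /=.
    case: (x ord0 i) xpos => [[|m]|m] // _.
    have -> : Posz m.+1 - 1 = Posz m by rewrite intS addrAC subrr add0r.
    by [].
  by rewrite (negbTE ji) subr0.
- apply: (step (x + unitv i)); first by apply/existsP; exists i; rewrite eqxx orbT.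
  apply/IH/l1D => [|j ji]; rewrite !mxE ?eqxx /=.
    case: (x ord0 i) xneg xi => [[|m]|m] // _ _.
    have -> : Negz m + 1 = - Posz m by rewrite NegzE intS opprD addrAC addNr add0r.
    by rewrite abszN.
  by rewrite (negbTE ji) addr0.
Qed.

Lemma sa_path_to d (x : V d) : exists s, sa_path 0 x s.
Proof.
have [p [vp <-]] := nn_path_to x; case/shortenP: vp => p' vp' up' _.
by exists (0 :: p'); split => //; apply/nn_pathP; exists p'.
Qed.

(** * Effect of changing a single weight *)

(** Since the edges of [s] are distinct, the changed weight is counted at most once. *)
Lemma passage_swap (R : realType) d (T : Type) (tau tau' : E d -> T -> R) om e s :
  uniq (edges s) -> (forall e', e' != e -> tau' e' om = tau e' om) ->
  passage tau om s =
  passage tau' om s + (if e \in edges s then tau e om - tau' e om else 0).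
Proof.
move=> us te; rewrite /passage; case: ifPn => es.
  rewrite (bigD1_seq e) //= [in RHS](bigD1_seq e) //=.
  rewrite [X in _ = _ + X + _](eq_bigr (fun i => tau i om)); last by move=> i /te.
  by rewrite [RHS]addrC addrA subrK.
rewrite addr0; apply: eq_big_seq => i ies; rewrite te //.
by apply: contraNneq es => <-.
Qed.

(* Lowering the weight of an edge e of s lowers all paths through e by the same
   amount, and the others not at all; so ties are not a problem. *)
Lemma first_geodesic_lower (R : realType) d (T : Type) rk
    (tau tau' : E d -> T -> R) om x e s :
  e \in edges s -> tau' e om <= tau e om ->
  (forall e', e' != e -> tau' e' om = tau e' om) ->
  first_geodesic rk tau om x s -> first_geodesic rk tau' om x s.
Proof.
move=> es le te [[sas geo] frst].
have ps := passage_swap (uniq_edges sas.2) te; rewrite es in ps.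
have ps' s' : sa_path 0 x s' ->
    passage tau om s' <= passage tau' om s' + (tau e om - tau' e om).
  move=> sas'; rewrite (passage_swap (uniq_edges sas'.2) te) lerD2l.
  by case: ifP; rewrite ?subr_ge0.
split.
  split=> // s' sas'; rewrite -(lerD2r (tau e om - tau' e om)) -ps.
  exact: le_trans (geo _ sas') (ps' _ sas').
(* A geodesic [s'] for [tau'] is also one for [tau]: its time under [tau] is at most its time under
   [tau'] plus the drop, hence at most that of [s]. So [s] still has the least rank. *)
move=> s' [sas' geo']; apply: frst; split=> // s'' sas''.
apply: le_trans (ps' _ sas') (le_trans _ (geo _ sas'')).
by rewrite ps lerD2r; exact: geo'.
Qed.

(** * Finite clusters and existence of geodesics *)

Section finite_reach.
Variables (d : nat).

Definition open_cluster (L : E d -> bool) (v : V d) : set (V d) :=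
  [set u | exists s, nn_path v u s /\ forall e, e \in edges s -> L e].

Lemma finite_adj (u : V d) : finite_set [set v | adj u v].
Proof.
apply: (@sub_finite_set _ _ ((fun i => u + unitv i) @` [set: 'I_d] `|`
   (fun i => u - unitv i) @` [set: 'I_d])).
  move=> v /= /existsP [i /orP [/eqP ->|/eqP ->]]; [left|right]; exists i => //.
  by rewrite addrK.
by rewrite finite_setU; split; apply: finite_image.
Qed.

Variable L : E d -> bool.
Hypothesis fin_cluster : forall v, finite_set (open_cluster L v).

(** Induction on the number of closed edges, those where [L] is false. Up to its first closed edge a
    path stays in the finite cluster of its start; that edge leads to one of finitely many vertices,
    from which the rest has one closed edge less. *)
Lemma finite_reach k v :
  finite_set [set u | exists s, nn_path v u s /\ (count (predC L) (edges s) <= k)%N].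
Proof.
elim: k v => [|k IH] v.
  apply: sub_finite_set (fin_cluster v) => u [s [vs cs]]; exists s; split=> // e es.
  move: cs; rewrite leqn0 eqn0Ngt -has_count => /hasPn /(_ _ es).
  by rewrite /= negbK.
pose A v := open_cluster L v `|` \bigcup_(u in open_cluster L v) \bigcup_(y in [set y | adj u y])
  [set z | exists s, nn_path y z s /\ (count (predC L) (edges s) <= k)%N].
apply: (@sub_finite_set _ _ (A v)); last first.
  rewrite finite_setU; split => //; apply: bigcup_finite => // u _.
  by apply: bigcup_finite => [|y _]; [exact: finite_adj|exact: IH].
have cl v' : open_cluster L v' v' by exists [:: v']; split=> //; apply/nn_pathP; exists [::].
move=> u [_ [/nn_pathP [p [-> <- vp]]]].
elim: p v vp => [|y p IHp] v /=; first by move=> _ _; left.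
move=> /andP [vy yp]; rewrite edges_cons; have [e ve] := edge_of_adj vy; rewrite ve /=.
case Le: (L e) => /=; last first.
  rewrite add1n ltnS => cp; right; exists v => //; exists y => //.
  by exists (y :: p); split=> //; apply/nn_pathP; exists p.
rewrite add0n => /(IHp _ yp).
have sub : open_cluster L y `<=` open_cluster L v.
  move=> z [_ [/nn_pathP [q [-> lq yq]] qL]]; exists [:: v, y & q]; split.
    by apply/nn_pathP; exists (y :: q); rewrite /= vy.
  by move=> f; rewrite edges_cons ve inE => /orP [/eqP ->|/qL].
case=> [/sub|[z /sub zv h]]; first by left.
by right; exists z.
Qed.

End finite_reach.

Fixpoint seqs_upto (A : Type) (l : seq A) n : seq (seq A) :=
  if n is n'.+1 then [::] :: [seq x :: s | x <- l, s <- seqs_upto l n'] else [:: [::]].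

Lemma mem_seqs_upto (A : eqType) (l : seq A) n s :
  {subset s <= l} -> (size s <= n)%N -> s \in seqs_upto l n.
Proof.
elim: n s => [|n IH] [|x s] //= sl; rewrite ltnS => ssn; rewrite in_cons /=.
apply/allpairsP; exists (x, s); split=> //=; first by apply: sl; rewrite mem_head.
by apply: IH => // y ys; apply: sl; rewrite in_cons ys orbT.
Qed.

Lemma seq_argmin (R : realType) (A : eqType) (f : A -> R) (l : seq A) a :
  a \in l -> exists2 b, b \in l & forall c, c \in l -> f b <= f c.
Proof.
elim: l a => [//|x l IH] a _.
case: l IH => [|y l] IH; first by exists x; rewrite ?mem_head // => c; rewrite inE => /eqP ->.
have [b bl bmin] := IH y (mem_head _ _).
have [xb|bx] := leP (f x) (f b).
  exists x; first exact: mem_head.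
  move=> c; rewrite in_cons => /orP [/eqP -> //|/bmin]; exact: le_trans.
exists b; first by rewrite in_cons bl orbT.
by move=> c; rewrite in_cons => /orP [/eqP ->|/bmin //]; exact: ltW.
Qed.

(* A path of passage time at most M has at most M / delta edges heavier than
   delta, so it is confined to a finite set. *)
Lemma exists_first_geodesic (R : realType) d (T : Type) rk (tau : E d -> T -> R)
    om x (delta : R) : (forall e, 0 <= tau e om) -> 0 < delta ->
  (forall v, finite_set (open_cluster (fun e => tau e om <= delta) v)) ->
  exists s, first_geodesic rk tau om x s.
Proof.
move=> t0 d0 fin.
have [s0 sas0] := sa_path_to x.
(* The time of an arbitrary self-avoiding path [s0] serves as the bound: slower paths need not be
   searched. *)
pose k := Num.truncn (passage tau om s0 / delta).
have /finite_seqP [l lE] := finite_reach fin k 0.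
have cand s : sa_path 0 x s -> passage tau om s <= passage tau om s0 ->
    s \in seqs_upto l (size l).
  move=> [/nn_pathP [p [-> lp vp]] us] ps.
  have cnt : (count (predC (fun e => (tau e om <= delta)%R)) (edges (0%R :: p)) <= k)%N.
    rewrite /k truncn_ge_nat; last first.
      by apply: divr_ge0; [exact: sumr_ge0|exact: ltW].
    rewrite ler_pdivlMr //; apply: le_trans ps; rewrite /passage.
    rewrite -sum1_count natr_sum mulr_suml [leRHS](bigID (predC (fun e => tau e om <= delta))) /=.
    rewrite ler_wpDr ?sumr_ge0 //; apply: ler_sum => e; rewrite -ltNge mul1r; exact: ltW.
  (* The initial piece of the path up to [y] has no more heavy edges than the whole path, so [y]
     itself lies in the finite set. *)
  have sub : {subset 0 :: p <= l}.
    move=> y yp; case/splitPl def_p: {1 2}p / yp => [p1 p2 ly].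
    have : [set` l] y.
      rewrite -lE; exists (0 :: p1); split.
        apply/nn_pathP; exists p1; split=> //.
        by move: vp; rewrite def_p cat_path => /andP [].
      by apply: leq_trans cnt; rewrite def_p edges_cat count_cat leq_addr.
    by [].
  (* A self-avoiding path inside [l] has at most [size l] vertices, so the candidates form a finite
     list. *)
  by apply: mem_seqs_upto => //; apply: uniq_leq_size.
pose geo s := `[< sa_path 0 x s >].
have [|s] := @seq_argmin R _ (passage tau om) [seq s <- seqs_upto l (size l) | geo s] s0.
  by rewrite mem_filter cand // andbT; apply/asboolP.
rewrite mem_filter => /andP [/asboolP sas _] smin.
have gs : geodesic tau om x s.
  split=> // s' sas'; have [le|/ltW ge] := leP (passage tau om s') (passage tau om s0).
    by apply: smin; rewrite mem_filter cand // andbT; apply/asboolP.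
  by apply: le_trans ge; apply: smin; rewrite mem_filter cand // andbT; apply/asboolP.
(* Ranks are natural numbers, so among the geodesics there is one of least rank. *)
pose Q n := `[< exists s, geodesic tau om x s /\ rk s = n >].
have exQ : exists n, Q n by exists (rk s); apply/asboolP; exists s.
case: (ex_minnP exQ) => n /asboolP [s1 [gs1 <-]] minn1.
exists s1; split=> // s' gs'; apply: minn1; apply/asboolP; by exists s'.
Qed.

(** * Measurability of the geodesic events *)

Lemma measurable_passage (R : realType) d (dT : measure_display)
    (T : measurableType dT) (tau : E d -> T -> R) s :
  (forall e, measurable_fun setT (tau e)) ->
  measurable_fun setT (fun om => passage tau om s).
Proof. by move=> mt; exact: measurable_sum. Qed.

Lemma countable_bigcapT_measurable (dT : measure_display) (T : measurableType dT)
    (U : countType) (F : U -> set T) :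
  (forall i, measurable (F i)) -> measurable (\bigcap_i F i).
Proof.
move=> mF; rewrite -[X in measurable X]setCK setC_bigcap; apply: measurableC.
by apply: countable_bigcupT_measurable => // i; exact: measurableC.
Qed.

(** Finite lists of vertices are countable, so the comparison with all competitors is a countable
    intersection. *)
Lemma measurable_geodesic (R : realType) d (dT : measure_display)
    (T : measurableType dT) (tau : E d -> T -> R) x s :
  (forall e, measurable_fun setT (tau e)) ->
  measurable [set om | geodesic tau om x s].
Proof.
move=> mt; have [sas|nsas] := pselect (sa_path 0 x s); last first.
  by rewrite [X in measurable X](_ : _ = set0) // -subset0 => om [].
rewrite [X in measurable X](_ : _ = \bigcap_(s' : seq (V d))
  [set om | sa_path 0 x s' -> passage tau om s <= passage tau om s']); last first.
  by apply/seteqP; split=> om => [[_ h] s' _|h] /=; [exact: h|split=> // s'; exact: h].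
apply: countable_bigcapT_measurable => s'.
have [sas'|nsas'] := pselect (sa_path 0 x s'); last first.
  by rewrite [X in measurable X](_ : _ = setT) // -subTset => om _ /nsas'.
rewrite [X in measurable X](_ : _ =
    [set om | passage tau om s <= passage tau om s']); last first.
  by apply/seteqP; split=> om /=; [apply|].
rewrite -[X in measurable X]setTI.
exact: (measurable_fun_ler (measurable_passage s mt) (measurable_passage s' mt) measurableT (Y := [set true])).
Qed.

Lemma measurable_first_geodesic (R : realType) d (dT : measure_display)
    (T : measurableType dT) rk (tau : E d -> T -> R) x s :
  (forall e, measurable_fun setT (tau e)) ->
  measurable [set om | first_geodesic rk tau om x s].
Proof.
move=> mt; rewrite [X in measurable X](_ : _ = [set om | geodesic tau om x s] `&`
   \bigcap_(s' : seq (V d)) (if (rk s <= rk s')%N then setT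
      else ~` [set om | geodesic tau om x s'])).
  apply: measurableI; first exact: measurable_geodesic.
  apply: countable_bigcapT_measurable => s'; case: ifP => // _.
  by apply: measurableC; exact: measurable_geodesic.
apply/seteqP; split=> om /= [gs h]; split=> // s'.
  by move=> _; case: ifPn => //= /negP + /h; apply.
by have := h s' I; case: ifPn.
Qed.

(** * Independence of one variable from all the others *)

Lemma probability_setD (R : realType) (dT : measure_display)
    (T : measurableType dT) (P : probability T R) (A B : set T) :
  measurable A -> measurable B -> B `<=` A -> P (A `\` B) = (P A - P B)%E.
Proof.
move=> mA mB BA; rewrite measureD // ?ltey_eq ?fin_num_measure //.
by rewrite (setIidr BA).
Qed.

Section independence.
Variables (R : realType) (dT : measure_display) (T : measurableType dT).
Variables (P : probability T R) (I : eqType) (X : I -> T -> R) (i0 : I).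
Hypothesis mX : forall i, measurable_fun setT (X i).
Hypothesis iX : indep_RVs P X.

(** Finite rectangles in the variables other than [X i0]: a pi-system that generates their
    sigma-algebra. *)
Definition cylinders : set (set T) :=
  [set A | exists (s : seq I) (B : I -> set R), [/\ uniq s, i0 \notin s,
     forall i, measurable (B i) & A = [set om | forall i, i \in s -> B i (X i om)]]].

Lemma measurable_cylinder (s : seq I) (B : I -> set R) : (forall i, measurable (B i)) ->
  measurable [set om | forall i, i \in s -> B i (X i om)].
Proof.
move=> mB; elim: s => [|i s IH].
  by rewrite [X in measurable X](_ : _ = setT) // -subTset => om _.
rewrite [Y in measurable Y](_ : _ = (X i @^-1` B i) `&`
   [set om | forall i, i \in s -> B i (X i om)]).
  by apply: measurableI => //; rewrite -[Y in measurable Y]setTI; exact: mX.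
apply/seteqP; split=> om /= => [h|[h1 h2] j].
  by split=> [|j js]; apply: h; rewrite in_cons ?eqxx ?js ?orbT.
by rewrite in_cons => /orP [/eqP ->|/h2].
Qed.

Lemma setI_closed_cylinders : setI_closed cylinders.
Proof.
move=> _ _ [s1 [B1 [u1 n1 m1 ->]]] [s2 [B2 [u2 n2 m2 ->]]].
exists (undup (s1 ++ s2)), (fun i => (if i \in s1 then B1 i else setT) `&`
  (if i \in s2 then B2 i else setT)); split.
- exact: undup_uniq.
- by rewrite mem_undup mem_cat negb_or n1.
- by move=> i; apply: measurableI; case: ifP.
apply/seteqP; split=> om /= => [[h1 h2] i _|h].
  by split; case: ifP => //; [exact: h1|exact: h2].
by split=> i si; have := h i; rewrite mem_undup mem_cat si ?orbT => /(_ isT) [].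
Qed.

(** Pi-lambda argument: the events independent of [H] form a lambda-system containing the
    cylinders. *)
Lemma indep_cylinders (B : set R) A : measurable B -> (<<s cylinders >>) A ->
  measurable A /\ P (A `&` X i0 @^-1` B) = (P A * P (X i0 @^-1` B))%E.
Proof.
move=> mB; set H := X i0 @^-1` B.
have mH : measurable H by rewrite -[Y in measurable Y]setTI; exact: mX.
have fP C : measurable C -> P C \is a fin_num by exact: fin_num_measure.
pose L := [set A | measurable A /\ P (A `&` H) = (P A * P H)%E].
apply: (@lambda_system_subset _ cylinders setI_closed_cylinders setT L) => //.
- split=> //.
  + by split; rewrite // setTI probability_setT mul1e.
  + move=> C D DC [mC iC] [mD iD]; split; first exact: measurableD.
    have -> : (C `\` D) `&` H = (C `&` H) `\` (D `&` H).
      apply/seteqP; split=> om /= => [[[c nd] h]|[[c h] nd]].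
        by split=> // [[]].
      by split=> //; split=> // dd; apply: nd.
    rewrite !probability_setD //; [|exact: measurableI..|exact: setSI].
    by rewrite iC iD muleBl ?fP // fin_num_adde_defr // fP.
  + move=> F ndF LF; have mF n : measurable (F n) by have [] := LF n.
    have mU : measurable (\bigcup_n F n) by exact: bigcupT_measurable.
    split=> //; rewrite setI_bigcupl.
    have c1 : (P (F n `&` H) @[n --> \oo] --> P (\bigcup_n (F n `&` H)))%E.
      apply: nondecreasing_cvg_mu => //.
      * by move=> n; exact: measurableI.
      * by apply: bigcupT_measurable => n; exact: measurableI.
      * move=> m n mn; apply/subsetPset; apply: setSI; apply/subsetPset; exact: ndF.
    have c2 : (P (F n `&` H) @[n --> \oo] --> P (\bigcup_n F n) * P H)%E.
      under eq_fun do rewrite (proj2 (LF _)).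
      by apply: cvgeZr; [exact: fP|exact: nondecreasing_cvg_mu].
    exact: (cvg_unique _ c1 c2).
- move=> _ [s [C [us ns mC ->]]]; split; first exact: measurable_cylinder.
  (* [H] constrains one more coordinate, so the intersection is a finite rectangle over [i0 :: s],
     to which [indep_RVs] applies. *)
  pose C' i := if i == i0 then B else C i.
  have mC' i : measurable (C' i) by rewrite /C'; case: ifP.
  have -> : [set om | forall i, i \in s -> C i (X i om)] `&` H =
      [set om | forall i, i \in i0 :: s -> C' i (X i om)].
    apply/seteqP; split=> om /= => [[h1 h2] i|h].
      rewrite in_cons /C'; case: eqP => [-> //|_ /=]; exact: h1.
    split=> [i is_|]; last by have := h i0; rewrite mem_head /C' eqxx; apply.
    have := h i; rewrite in_cons is_ orbT /C'; case: eqP => [ii0|_]; last exact.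
    by move: ns; rewrite -ii0 is_.
  have us' : uniq (i0 :: s) by rewrite /= us ns.
  have /= -> := iX mC' us'.
  rewrite big_cons muleC; congr (_ * _)%E; last by rewrite /C' eqxx.
  have /= -> := iX mC us; apply: eq_big_seq => i is_.
  by rewrite /C'; case: eqP => // ii0; move: ns; rewrite -ii0 is_.
Qed.

End independence.

(** * Association of the geodesic event with a light edge *)

(** Allows the measurability lemmas for geodesics to be applied over the smaller sigma-algebra of
    the variables other than [X i0]. *)
Lemma measurable_cylinder_sub (R : realType) (dT : measure_display)
    (T : measurableType dT) (I : eqType) (X : I -> T -> R) i0 i : i != i0 ->
  measurable_fun [set: g_sigma_algebraType (cylinders X i0)]
    (X i : g_sigma_algebraType (cylinders X i0) -> R).
Proof.
move=> ii0 _ B mB; rewrite setTI; apply: sub_sigma_algebra.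
exists [:: i], (fun=> B); split=> //; first by rewrite inE eq_sym.
by apply/seteqP; split=> om /= => [h j|]; [rewrite inE => /eqP ->|apply; rewrite inE].
Qed.

(* Chebyshev's association inequality for the decreasing events G and H. Its only
   input is the event Ga, where the weight of e is frozen at a: Ga is independent of
   tau e, contained in G on H, and contains G off H. *)
Lemma first_geodesic_le_association (R : realType) d (dT : measure_display)
    (T : measurableType dT) (P : probability T R) (tau : E d -> T -> R) rk x s e (a : R) :
  (forall e, measurable_fun setT (tau e)) -> indep_RVs P tau -> e \in edges s ->
  (P [set om | first_geodesic rk tau om x s] * P [set om | (tau e om <= a)%R] <=
   P ([set om | first_geodesic rk tau om x s] `&` [set om | (tau e om <= a)%R]))%E.
Proof.
move=> mt it es; set G := [set om | _]; set H := [set om | _].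
pose taua e' om := if e' == e then a else tau e' om.
set Ga := [set om | first_geodesic rk taua om x s].
(* A constant replaces the weight of [e], the only one that need not be measurable for the
   sigma-algebra of the other weights. *)
have sGa : (<<s cylinders tau e >>) Ga.
  have : measurable (Ga : set (g_sigma_algebraType (cylinders tau e))).
    apply: measurable_first_geodesic => e'; rewrite /taua.
    by case: eqVneq => [_|ee]; [exact: measurable_cst|exact: measurable_cylinder_sub].
  exact.
have [mGa iH] := indep_cylinders mt it (measurable_itv `]-oo, a]) sGa.
have [_ iHc] := indep_cylinders mt it (measurable_itv `]a, +oo[) sGa.
have HE : tau e @^-1` [set` `]-oo, a]] = H.
  by apply/seteqP; split=> om /=; rewrite in_itv.
have HcE : tau e @^-1` [set` `]a, +oo[] = ~` H.
  by apply/seteqP; split=> om /=; rewrite in_itv /= andbT ltNge => /negP.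
rewrite HE in iH; rewrite HcE in iHc.
have mG : measurable G by exact: measurable_first_geodesic.
have mH : measurable H by rewrite -HE -[X in measurable X]setTI; exact: mt.
have mHc := measurableC mH.
have s1 : Ga `&` H `<=` G `&` H.
  move=> om [gs h]; split=> //.
  apply: (first_geodesic_lower es _ _ gs); rewrite /taua ?eqxx //.
  by move=> e' /negbTE ->.
have s2 : G `&` ~` H `<=` Ga `&` ~` H.
  move=> om [gs h]; split=> //.
  apply: (first_geodesic_lower es _ _ gs); rewrite /taua ?eqxx //.
    by rewrite ltW // ltNge; exact/negP.
  by move=> e' /negbTE ->.
have l1 : (P (Ga `&` H) <= P (G `&` H))%E.
  by apply: le_measure => //; rewrite inE; exact: measurableI.
have l2 : (P (G `&` ~` H) <= P (Ga `&` ~` H))%E.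
  by apply: le_measure => //; rewrite inE; exact: measurableI.
have GE : P G = (P (G `&` H) + P (G `&` ~` H))%E.
  by rewrite -measureU ?setIUr; [rewrite -setIUr setUv setIT|exact: measurableI..|rewrite setIACA setICr setI0].
move: l1 l2; rewrite iH iHc GE (probability_setC P mH).
have fP C : measurable C -> exists r, P C = r%:E.
  by move=> mC; exists (fine (P C)); rewrite fineK // fin_num_measure.
have := probability_le1 P mH; have : (0 <= P H)%E := measure_ge0 P H.
have [h ->] := fP _ mH; have [ga ->] := fP _ mGa.
have [g1 ->] := fP _ (measurableI _ _ mG mH).
have [g2 ->] := fP _ (measurableI _ _ mG mHc).
rewrite -EFinN -!EFinD -!EFinM !lee_fin.
(* The goal amounts to [g2 * h <= g1 * (1 - h)]; both sides are compared with [ga * h * (1 - h)]. *)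
move=> h0 h1 l1 l2.
have : g2 * h <= ga * (1 - h) * h by rewrite ler_wpM2r.
have : ga * h * (1 - h) <= g1 * (1 - h) by rewrite ler_wpM2r // subr_ge0.
nra.
Qed.

(** * Bernoulli digits of a uniform variable *)

(* The nested intervals [a, a + l) are split in the proportions q and 1 - q; digit n
   says whether u falls in the left part at the n-th split. *)
Fixpoint digit (R : realType) (q a l u : R) (n : nat) : bool :=
  if n is n'.+1 then
    if u < a + q * l then digit q a (q * l) u n'
    else digit q (a + q * l) ((1 - q) * l) u n'
  else u < a + q * l.

Lemma measurable_digit (R : realType) (q a l : R) n :
  measurable [set u | digit q a l u n].
Proof.
rewrite -[X in measurable X]setTI.
suff mf : measurable_fun setT (fun u => digit q a l u n).
  exact: (mf measurableT [set true]).
elim: n a l => [|n IH] a l /=; first exact: measurable_fun_ltr.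
apply: measurable_fun_if => //; first exact: measurable_fun_ltr.
- exact: measurable_funS (IH _ _).
- exact: measurable_funS (IH _ _).
Qed.

(** The first split separates points by digit 0, and the later digits of a point are its digits
    within its part. Induction applies to the parts of lengths [q * l] and [(1 - q) * l], the right
    one counting only when digit 0 is unconstrained. *)
Lemma lebesgue_digits (R : realType) (q : R) n (S : pred nat) (a l : R) :
  0 <= q <= 1 -> 0 <= l ->
  lebesgue_measure [set u : R | a <= u < a + l /\
     forall i, (i < n)%N -> S i -> digit q a l u i] =
  (l * \prod_(i < n) (if S i then q else 1))%:E.
Proof.
move=> /andP [q0 q1]; elim: n S a l => [|n IH] S a l l0.
  rewrite big_ord0 mulr1 [X in lebesgue_measure X](_ : _ = [set` `[a, a + l[]).
    rewrite lebesgue_measure_itv /= lte_fin ltrDl.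
    have [_|] := ltrP 0 l; first by rewrite -EFinB addrAC subrr add0r.
    by move=> l0'; congr EFin; apply/le_anti; rewrite l0 l0'.
  by apply/seteqP; split=> u /=; rewrite in_itv /=; [case|split].
set D := [set u | _].
pose D1 := [set u : R | a <= u < a + q * l /\
     forall i, (i < n)%N -> S i.+1 -> digit q a (q * l) u i].
pose D2 := [set u : R | a + q * l <= u < a + q * l + (1 - q) * l /\
     forall i, (i < n)%N -> S i.+1 -> digit q (a + q * l) ((1 - q) * l) u i].
have ql0 : 0 <= q * l by rewrite mulr_ge0.
have pl0 : 0 <= (1 - q) * l by rewrite mulr_ge0 // subr_ge0.
have aE : a + q * l + (1 - q) * l = a + l by ring.
have mD (S' : pred nat) a' l' : measurable [set u : R | a' <= u < a' + l' /\
     forall i, (i < n)%N -> S' i -> digit q a' l' u i].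
  rewrite [X in measurable X](_ : _ = [set` `[a', a' + l'[] `&`
    \bigcap_(i in [set i | (i < n)%N /\ S' i]) [set u | digit q a' l' u i]).
    apply: measurableI => //; apply: bigcap_measurableType => i _.
    exact: measurable_digit.
  apply/seteqP; split=> u /=; rewrite in_itv /= => [] [h1 h2]; split=> //.
    by move=> i [] /=; exact: h2.
  by move=> i ni Si; apply: h2.
have -> : D = D1 `|` (if S 0%N then set0 else D2).
  apply/seteqP; split=> u /=.
    move=> [/andP [au ul] h]; have [uq|uq] := ltP u (a + q * l).
      left; split; first by rewrite au.
      by move=> i ni Si; have := h i.+1 ni Si; rewrite /= uq.
    right; case: ifPn => [S0|_].
      by have := h 0%N isT S0; rewrite /= ltNge uq.
    split; first by rewrite uq aE.
    by move=> i ni Si; have := h i.+1 ni Si; rewrite /= ltNge uq.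
  move=> [[/andP [au uq] h]|].
    split; first by rewrite au /=; apply: (lt_le_trans uq); rewrite lerD2l ler_piMl.
    by move=> [|i] ni Si /=; rewrite uq //; exact: h.
  case: ifPn => // /negbTE S0 [/andP [uq ul] h]; split.
    by rewrite -aE ul andbT (le_trans _ uq) // lerDl.
  by move=> [|i] ni; rewrite ?S0 //= ltNge uq /=; exact: h.
have /= := @IH (fun i => S i.+1) a (q * l) ql0; rewrite -/D1 => D1E.
have /= := @IH (fun i => S i.+1) (a + q * l) ((1 - q) * l) pl0; rewrite -/D2 => D2E.
rewrite big_ord_recl /=.
case: ifP => S0; first by rewrite setU0 D1E; congr EFin; ring.
rewrite measureU; [|exact: mD..|].
- rewrite /= in D1E D2E; rewrite [X in (X + _)%E]D1E [X in (_ + X)%E]D2E -EFinD.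
  by congr EFin; ring.
- apply/seteqP; split=> u //= [[/andP [_ u1] _] [/andP [u2 _] _]].
  by move: u1; rewrite ltNge u2.
Qed.

Definition unif01 (R : realType) : probability (measurableTypeR R) R :=
  uniform_prob (@ltr01 R).

Lemma unif01E (R : realType) (A : set R) : measurable A -> A `<=` [set` `[0, 1]] ->
  unif01 R A = lebesgue_measure A.
Proof.
move=> mA A01; rewrite /unif01 /= /uniform_prob (eq_integral (cst 1%E)).
  by rewrite integral_cst //= mul1e.
by move=> u; rewrite inE => /A01 /=; rewrite in_itv /uniform_pdf /= => ->; rewrite subr0 invr1.
Qed.

Lemma probability_setI_full (R : realType) (dT : measure_display)
    (T : measurableType dT) (P : probability T R) (A B : set T) :
  measurable A -> measurable B -> P (~` B) = 0%E -> P (A `&` B) = P A.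
Proof.
move=> mA mB PB; rewrite -setDD.
have mAB : measurable (A `\` B) by exact: measurableD.
have AB0 : P (A `\` B) = 0%E.
  apply/eqP; rewrite eq_le measure_ge0 andbT -PB.
  by apply: le_measure; rewrite ?inE //; exact: measurableC.
by rewrite probability_setD // AB0 sube0.
Qed.

Lemma indep_digits (R : realType) (q : R) : 0 <= q <= 1 ->
  forall s : seq nat, uniq s ->
  unif01 R [set u | forall i, i \in s -> digit q 0 1 u i] =
  (q ^+ size s)%:E.
Proof.
move=> q01 s us; set Q := unif01 R.
(* Any bound above all positions in [s] works: the other positions are unconstrained and contribute
   a factor 1. *)
pose n := (\max_(i <- s) i).+1.
have ns i : i \in s -> (i < n)%N by move=> si; rewrite ltnS; exact: leq_bigmax_seq.
have mD : measurable [set u | forall i, i \in s -> digit q 0 1 u i].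
  rewrite [X in measurable X](_ : _ = \bigcap_(i in [set i | i \in s]) [set u | digit q 0 1 u i]).
    by apply: bigcap_measurableType => i _; exact: measurable_digit.
  by apply/seteqP; split=> u /= h i; apply: h.
(* [lebesgue_digits] works in a half-open interval and the uniform law on the closed one; the
   endpoint is null. *)
have m01 : measurable [set` `[(0:R), 1[] by [].
have Q01 : Q (~` [set` `[(0:R), 1[]) = 0%E.
  rewrite /Q probability_setC // unif01E //.
    by rewrite lebesgue_measure_itv /= lte_fin ltr01 -!EFinB subr0 subrr.
  by move=> u /=; rewrite !in_itv /= => /andP [-> /ltW].
have -> : Q [set u | forall i, i \in s -> digit q 0 1 u i] =
    Q ([set u | forall i, i \in s -> digit q 0 1 u i] `&` [set` `[(0:R), 1[]).
  by rewrite probability_setI_full.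
rewrite /Q unif01E; last 2 first.
- exact: measurableI.
- by move=> u [_] /=; rewrite !in_itv /= => /andP [-> /ltW].
have := @lebesgue_digits R q n (mem s) 0 1 q01 ler01; rewrite mul1r add0r.
set D := [set u | _]; set D' := _ `&` _.
have -> : D = D'.
  apply/seteqP; split=> u; rewrite /D /D' /= in_itv /= => [] [h1 h2].
    by split=> // i is_; apply: h2 => //; exact: ns.
  by split=> // i _ is_; exact: h1.
move=> ->; congr EFin.
rewrite -(big_mkord predT (fun i => if i \in s then q else 1)) -big_mkcond /=.
rewrite -big_filter big_const_seq count_predT.
rewrite (_ : size _ = size s); first by rewrite -Monoid.iteropE.
apply: perm_size; apply: uniq_perm => //; first by rewrite filter_uniq // iota_uniq.
by move=> i; rewrite mem_filter mem_index_iota /= andb_idr // => /ns.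
Qed.

(** * Independence under complements and unions *)

Section indep_lemmas.
Variables (R : realType) (I : eqType).

Lemma measurable_forall_in (dT : measure_display) (T : measurableType dT)
    (A : I -> set T) (s : seq I) : (forall i, measurable (A i)) ->
  measurable [set om | forall i, i \in s -> A i om].
Proof.
move=> mA; rewrite [X in measurable X](_ : _ = \bigcap_(i in [set` s]) A i) //.
by apply: fin_bigcap_measurable => // i _; exact: mA.
Qed.

Lemma indep_events_setC (dT : measure_display) (T : measurableType dT)
    (P : probability T R) (A : I -> set T) : (forall i, measurable (A i)) ->
  indep_events P A -> indep_events P (fun i => ~` A i).
Proof.
move=> mA iA.
have mAC i : measurable (~` A i) by exact: measurableC.
(* The induction needs this mixed form, with events on [s] and complements on [t]: taking a
   difference of probabilities moves an index from [t] to [s]. *)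
suff H t s : uniq (s ++ t) ->
    P ([set om | forall i, i \in s -> A i om] `&`
       [set om | forall i, i \in t -> ~ A i om]) =
    (\prod_(i <- s) P (A i) * \prod_(i <- t) P (~` A i))%E.
  move=> t ut; have := H t [::] ut; rewrite big_nil mul1e => <-.
  by congr (P _); apply/seteqP; split=> om //= [].
elim: t s => [|i t IH] s; rewrite ?cats0 => us.
  rewrite big_nil mule1 -iA //; congr (P _).
  by apply/seteqP; split=> om // [].
have us1 : uniq (i :: s ++ t) by rewrite -[i :: _]/([:: i] ++ s ++ t) uniq_catCA.
have us2 : uniq (s ++ t) by case/andP: us1.
have mX := measurable_forall_in s mA.
have mY := measurable_forall_in t mAC.
have mX' := measurable_forall_in (i :: s) mA.
rewrite (_ : _ `&` _ = ([set om | forall j, j \in s -> A j om] `&`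
    [set om | forall j, j \in t -> ~ A j om]) `\`
    ([set om | forall j, j \in i :: s -> A j om] `&`
    [set om | forall j, j \in t -> ~ A j om])); last first.
  apply/seteqP; split=> om /= => [[h1 h2]|[[h1 h2] h3]].
    split; first by split=> // j jt; apply: h2; rewrite in_cons jt orbT.
    by move=> [h3 _]; apply: (h2 i); [exact: mem_head|apply: h3; exact: mem_head].
  split=> // j; rewrite in_cons => /orP [/eqP -> Ai|]; last exact: h2.
  by apply: h3; split=> // k; rewrite in_cons => /orP [/eqP ->|/h1].
rewrite probability_setD; [|exact: measurableI..|]; last first.
  by apply: setSI => om /= h j js; apply: h; rewrite in_cons js orbT.
rewrite !IH // !big_cons (probability_setC P (mA i)).
have fA j : P (A j) \is a fin_num by apply: fin_num_measure.
have fAC j : P (~` A j) \is a fin_num by apply: fin_num_measure; exact: mAC.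
have fp (B : I -> set T) r : (forall j, P (B j) \is a fin_num) ->
    (\prod_(j <- r) P (B j))%E \is a fin_num.
  move=> fB; elim: r => [|j r ihr]; first by rewrite big_nil.
  by rewrite big_cons fin_numM.
have f1 := fp A s fA; have f2 := fp (fun j => ~` A j) t fAC.
move: (P (A i)) (fA i) (\prod_(j <- s) P (A j))%E f1 (\prod_(j <- t) P (~` A j))%E f2 => [p||] // _ [a||] // _ [b||] // _.
rewrite [(1 - p%:E)%E](_ : _ = (1 - p)%:E) // -!EFinM -EFinB.
by congr EFin; ring.
Qed.

(** The complement of each union is a rectangle, so its probability factors; independence passes to
    the complements and back. *)
Lemma indep_events_setU_prod (d1 d2 : measure_display) (T1 : measurableType d1)
    (T2 : measurableType d2) (P : probability T1 R) (Q : probability T2 R)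
    (A : I -> set T1) (B : I -> set T2) :
  (forall i, measurable (A i)) -> (forall i, measurable (B i)) ->
  indep_events P A -> indep_events Q B ->
  indep_events (P \x Q)%E (fun i => [set z | A i z.1 \/ B i z.2]).
Proof.
move=> mA mB iA iB.
pose W i := [set z : T1 * T2 | A i z.1 \/ B i z.2].
have WC i : ~` W i = ~` A i `*` ~` B i.
  by apply/seteqP; split=> z /=; rewrite /W /= not_orE.
have mWC i : measurable (~` W i).
  by rewrite WC; apply: measurableX; exact: measurableC.
have -> : (fun i => [set z | A i z.1 \/ B i z.2]) = (fun i => ~` ~` W i).
  by apply/funext => i; rewrite setCK.
apply: indep_events_setC => // s us.
have iA' := indep_events_setC mA iA us; have iB' := indep_events_setC mB iB us.
rewrite (_ : [set w | _] = [set om | forall i, i \in s -> (~` A i) om] `*`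
  [set om | forall i, i \in s -> (~` B i) om]); last first.
  apply/seteqP; split=> z /= => [h|[h1 h2] i is_].
    by split=> i is_; have : (~` W i) z := h i is_; rewrite WC => [] [].
  by suff : (~` W i) z by []; rewrite WC; split; [exact: h1|exact: h2].
transitivity (P [set om | forall i, i \in s -> (~` A i) om] *
   Q [set om | forall i, i \in s -> (~` B i) om])%E.
  by apply: product_measure1E; apply: measurable_forall_in => i; exact: measurableC.
rewrite [X in (X * _)%E]iA' [X in (_ * X)%E]iB' -big_split /=.
apply: eq_bigr => i _; rewrite WC; apply/esym; apply: product_measure1E;
  exact: measurableC.
Qed.

End indep_lemmas.

(** * Subcritical percolation has finite clusters *)

Lemma probability_setC_eq (R : realType) (dT : measure_display)
    (T : measurableType dT) (P : probability T R) (A : set T) (r : R) :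
  measurable A -> P (~` A) = r%:E -> P A = (1 - r)%:E.
Proof.
move=> mA PA; rewrite -[A]setCK probability_setC ?PA //; exact: measurableC.
Qed.

(** Turns infinitude into a countable condition on codes, which makes the percolation event
    measurable. *)
Lemma infinite_setP (A : countType) (S : set A) :
  ~ finite_set S <-> forall n, exists v, S v /\ (n <= pickle v)%N.
Proof.
split=> [infS n|h /finite_seqP [s sE]]; last first.
  have [v [Sv]] := h (\max_(v <- s) pickle v).+1; rewrite sE /= in Sv.
  by rewrite ltnNge leq_bigmax_seq.
apply: contrapT => h; apply: infS.
apply: (@sub_finite_set _ _ [set v | (pickle v < n)%N]).
  by move=> v Sv /=; rewrite ltnNge; apply/negP => nv; apply: h; exists v.
apply: (@finite_preimage _ _ `I_n (@pickle A)) => //.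
by move=> u v _ _; exact: (pcan_inj (@pickleK A)).
Qed.

Lemma measurable_perc_event d (dT : measure_display) (T : measurableType dT)
    (w : E d -> T -> bool) : (forall e, measurable [set om | w e om]) ->
  measurable (perc_event w).
Proof.
move=> mw; rewrite [X in measurable X](_ : _ = \bigcap_n \bigcup_(v : V d)
   \bigcup_(s : seq (V d)) [set om | ((n <= pickle v)%N /\ nn_path 0 v s) /\
     forall e, e \in edges s -> w e om]).
  apply: bigcapT_measurable => n; apply: countable_bigcupT_measurable => [|v].
    exact: countableP.
  apply: countable_bigcupT_measurable => [|s]; first exact: countableP.
  have [h|nh] := pselect ((n <= pickle v)%N /\ nn_path 0 v s); last first.
    by rewrite [X in measurable X](_ : _ = set0) // -subset0 => om [].
  rewrite [X in measurable X](_ : _ = [set om | forall e, e \in edges s -> w e om]).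
    exact: (measurable_forall_in (A := fun e => [set om | w e om])).
  by apply/seteqP; split=> om /=; [case|split].
apply/seteqP; split=> om /=.
  move=> /infinite_setP h n _; have [v [[s [vs sw]] nv]] := h n.
  by exists v => //; exists s.
move=> h; apply/infinite_setP => n; have [v _ [s _ [[nv vs] sw]]] := h n I.
by exists v; split=> //; exists s.
Qed.

(** As [p_c] is a supremum, [q < p_c] yields some [p > q] at which percolation has probability 0.
    Opening further edges independently raises the parameter from [q] to [p] and can only enlarge
    the cluster of 0. *)
Lemma perc_event_subcritical (R : realType) d (dT : measure_display)
    (T : measurableType dT) (P : probability T R) (q : R) (w : E d -> T -> bool) :
  bernoulli_bond P q w -> q < p_c R d -> 0 <= q -> P (perc_event w) = 0%E.
Proof.
move=> [mw iw Pw] + q0; rewrite /p_c; set S := [set p | _] => qS.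
(* The supremum of the empty set is 0, which is not above [q]. *)
have S0 : S !=set0.
  by apply/set0P/eqP => S0; move: qS; rewrite S0 sup0 ltNge q0.
have [p [/andP [p0 p1] Sp] qp] := sup_gt S0 qS.
pose a := (p - q) / (1 - q).
have q1 : 0 < 1 - q by rewrite subr_gt0 (lt_le_trans qp).
have a01 : 0 <= a <= 1.
  apply/andP; split; last by rewrite ler_pdivrMr // mul1r lerD2r.
  by apply: divr_ge0; [rewrite subr_ge0 ltW|exact: ltW].
pose Q := unif01 R.
(* One uniform variable serves all edges: each edge reads the digit at its own code. *)
pose b (e : E d) (u : R) := digit a 0 1 u (pickle e).
have mb e : measurable ([set u | b e u] : set (measurableTypeR R)) by exact: measurable_digit.
have ib s : uniq s -> Q [set u | forall e, e \in s -> b e u] = (a ^+ size s)%:E.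
  move=> us; rewrite -(size_map pickle) -indep_digits //; last first.
    by rewrite map_inj_uniq //; exact: (pcan_inj (@pickleK _)).
  congr (Q _); apply/seteqP; split=> u /= h i; last first.
    by move=> is_; apply: h; exact: map_f.
  by move=> /mapP [e es ->]; exact: h.
have Qb e : Q [set u | b e u] = a%:E.
  rewrite -[a]expr1 -(ib [:: e]) //; congr (Q _); apply/seteqP; split=> u /= h.
    by move=> e'; rewrite inE => /eqP ->.
  by apply: h; rewrite inE.
have iB : indep_events Q (fun e => [set u | b e u]).
  move=> s us; rewrite [LHS](ib _ us) (eq_bigr (fun=> a%:E)); last by move=> e _; exact: Qb.
  elim: s {us} => [|e s IH]; first by rewrite big_nil.
  by rewrite /= exprS EFinM IH big_cons.
pose w' e (z : T * measurableTypeR R) := w e z.1 || b e z.2.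
have W e : [set z | w' e z] = [set z : T * measurableTypeR R | w e z.1 \/ b e z.2].
  by apply/seteqP; split=> z /= /orP.
have WC e : ~` [set z | w' e z] = ~` [set om | w e om] `*` ~` [set u | b e u].
  by rewrite W; apply/seteqP; split=> z /=; rewrite not_orE.
have mw' e : measurable [set z | w' e z].
  rewrite -[X in measurable X]setCK; apply: measurableC; rewrite WC.
  by apply: measurableX; [exact: measurableC (mw e)|exact: measurableC (mb e)].
have Bw' : bernoulli_bond (P \x Q)%E p w'.
  split=> // [|e].
    rewrite (_ : (fun e => _) = (fun e => [set z : T * measurableTypeR R | w e z.1 \/ b e z.2])).
      exact: (@indep_events_setU_prod R (E d) _ _ _ _ P Q
        (fun e => [set om | w e om]) (fun e => [set u | b e u])).
    by apply/funext => e; exact: W.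
  have -> : p = 1 - (1 - q) * (1 - a) by rewrite /a; field; exact: lt0r_neq0.
  apply: probability_setC_eq => //; rewrite WC.
  have -> : ((1 - q) * (1 - a))%:E = (P (~` [set om | w e om]) * Q (~` [set u | b e u]))%E.
    by rewrite !probability_setC // Pw Qb.
  by apply: product_measure1E; [exact: measurableC (mw e)|exact: measurableC (mb e)].
(* Membership of [p] in [S] quantifies over all probability spaces, hence covers this product. *)
have := Sp _ _ _ _ Bw' => Pw'.
have mp := measurable_perc_event mw; have mp' := measurable_perc_event mw'.
have PQ : (P \x Q)%E (perc_event w `*` setT) = P (perc_event w).
  transitivity (P (perc_event w) * Q setT)%E; first exact: product_measure1E.
  by rewrite probability_setT mule1.
apply/eqP; rewrite eq_le measure_ge0 andbT -PQ -Pw'.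
apply: le_measure; rewrite ?inE //; first exact: measurableX.
move=> z [/= pz _] fz; apply: pz; apply: sub_finite_set fz.
by move=> v [s [vs sw]]; exists s; split=> // e es; rewrite /w' sw.
Qed.

Lemma edges_shift d (v : V d) s :
  edges [seq y - v | y <- s] = [seq (e.1 - v, e.2) | e <- edges s].
Proof.
have shiftE (a b c : V d) : (a - v == b - v + c) = (a == b + c).
  by rewrite addrAC (can_eq (subrK v)).
have edge_shift a b : edge_of (a - v) (b - v) =
    omap (fun e : E d => (e.1 - v, e.2)) (edge_of a b).
  rewrite /edge_of (eq_pick (Q := fun i => b == a + unitv i)); last by move=> i; exact: shiftE.
  case: pickP => //= _.
  rewrite (eq_pick (Q := fun i => a == b + unitv i)); last by move=> i; exact: shiftE.
  by case: pickP.
elim: s => [//|x [//|y s] IH]; rewrite /= in IH *; rewrite !edges_cons edge_shift IH.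
by case: edge_of.
Qed.

Lemma adj_shift d (v a b : V d) : adj (a - v) (b - v) = adj a b.
Proof.
apply: eq_existsb => i; rewrite [a - v + _]addrAC [b - v + _]addrAC.
by rewrite !(can_eq (subrK v)).
Qed.

(** [perc_event] concerns the cluster of the origin; translating the configuration reaches that of
    [v]. *)
Lemma open_cluster_shift d (L : E d -> bool) (v : V d) :
  finite_set (open_cluster (fun e : E d => L (e.1 + v, e.2)) 0) -> finite_set (open_cluster L v).
Proof.
move=> fin; apply: sub_finite_set (finite_image (fun u => u + v) fin).
move=> u [_ [/nn_pathP [p [-> lp vp]] pL]]; exists (u - v); last by rewrite subrK.
exists [seq y - v | y <- v :: p]; split.
  apply/nn_pathP; exists [seq y - v | y <- p]; rewrite /= subrr; split=> //.
    by rewrite -lp -(last_map (fun y => y - v)) subrr.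
  have := mono_path (f := fun y => y - v) (x := v) (s := p) (adj_shift v).
  by rewrite /= subrr => ->.
move=> e; rewrite edges_shift => /mapP [f fp ->] /=.
by rewrite subrK -surjective_pairing; exact: pL.
Qed.

Lemma bernoulli_bond_shift (R : realType) d (dT : measure_display)
    (T : measurableType dT) (P : probability T R) (q : R) (w : E d -> T -> bool) (v : V d) :
  bernoulli_bond P q w -> bernoulli_bond P q (fun e : E d => w (e.1 + v, e.2)).
Proof.
move=> [mw iw Pw]; split=> // s us.
have inj : injective (fun e : E d => (e.1 + v, e.2)).
  by move=> [a i] [b j] /= [/(can_inj (addrK v)) -> ->].
have us' : uniq [seq (e.1 + v, e.2) | e <- s] by rewrite map_inj_uniq.
have := iw _ us'; rewrite big_map => <-; congr (P _).
apply/seteqP; split=> om /= h e.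
  by move=> /mapP [f fs ->]; exact: h.
by move=> es; apply: (h (e.1 + v, e.2)); apply/mapP; exists e.
Qed.

(** Each vertex has a null exceptional event, by translation to the origin, and there are countably
    many vertices. *)
Lemma finite_clusters_subcritical (R : realType) d (dT : measure_display)
    (T : measurableType dT) (P : probability T R) (q : R) (w : E d -> T -> bool) :
  bernoulli_bond P q w -> q < p_c R d -> 0 <= q ->
  P.-negligible [set om | ~ forall v, finite_set (open_cluster (fun e => w e om) v)].
Proof.
move=> Bw qp q0; pose N v := perc_event (fun e : E d => w (e.1 + v, e.2)).
apply: (@negligibleS _ _ _ _ (\bigcup_n (if unpickle n is Some v then N v else set0))).
  move=> om /= /existsNP [v fv]; exists (pickle v) => //; rewrite pickleK => fin.
  exact/fv/open_cluster_shift.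
apply: negligible_bigcup => n; case: (unpickle n) => [v|]; last exact: negligible_set0.
have Bv := bernoulli_bond_shift v Bw.
apply/negligibleP; last exact: perc_event_subcritical Bv qp q0.
by case: Bv => mw _ _; exact: measurable_perc_event.
Qed.

(** * Distribution function and essential infimum *)

Lemma probability_fine (R : realType) (dT : measure_display) (T : measurableType dT)
    (P : probability T R) (A : set T) : measurable A -> (fine (P A))%:E = P A.
Proof. by move=> mA; rewrite fineK // fin_num_measure. Qed.

(** [distF] vanishes at every point below the infimum, and the open half-line is a countable union
    of closed ones ending at such points. *)
Lemma mu_lt_ess_inf (R : realType) (mu : probability R R) :
  has_lbound [set a : R | 0 < distF mu a] -> mu [set` `]-oo, ess_inf mu[] = 0%E.
Proof.
move=> lb.
have F0 a : a < ess_inf mu -> mu [set` `]-oo, a]] = 0%E.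
  move=> ar; rewrite -probability_fine //; congr EFin.
  apply/le_anti; rewrite fine_ge0 // andbT leNgt; apply/negP => Fa.
  by move: ar; rewrite ltNge ge_inf.
apply/negligibleP => //.
apply: (@negligibleS _ _ _ _ (\bigcup_n [set` `]-oo, ess_inf mu - n.+1%:R^-1]])).
  move=> u /=; rewrite in_itv /= => /ltr_add_invr [k uk].
  by exists k => //=; rewrite in_itv /= lerBrDr ltW.
apply: negligible_bigcup => n; apply/negligibleP => //; apply: F0.
by rewrite ltrBlDr ltrDl invr_gt0.
Qed.

(** Right-continuity, from continuity of [mu] from above along [a + 1 / (n + 1)]. It leaves room for
    a positive [delta] above a zero infimum. *)
Lemma distF_right_lt (R : realType) (mu : probability R R) (a c : R) :
  distF mu a < c -> exists2 b, a < b & distF mu b < c.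
Proof.
move=> ac; pose F n := [set` `]-oo, a + n.+1%:R^-1]] : set R.
have mF n : measurable (F n) by exact: measurable_itv.
have FE : \bigcap_n F n = [set` `]-oo, a]].
  apply/seteqP; split=> u /=.
    move=> h; rewrite in_itv /= leNgt; apply/negP => /ltr_add_invr [k ku].
    by have := h k I; rewrite /F /= in_itv /= leNgt ku.
  by rewrite in_itv /= => ua n _; rewrite /F /= in_itv /= (le_trans ua) // lerDl.
have cF : mu (F n) @[n --> \oo] --> mu (\bigcap_n F n).
  apply: nonincreasing_cvg_mu => //.
  - by apply: (le_lt_trans (probability_le1 mu (mF 0%N))); rewrite ltry.
  - by rewrite FE.
  - move=> m n mn; apply/subsetPset => u; rewrite /F /= !in_itv /= => /le_trans; apply.
    by rewrite lerD2l lef_pV2 ?posrE // ler_nat.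
have : mu (F n) @[n --> \oo] --> (distF mu a)%:E.
  by rewrite /distF -FE probability_fine // FE.
move=> /fine_cvg /cvgr_lt /(_ _ ac) [n _ /(_ n (leqnn n)) h].
by exists (a + n.+1%:R^-1); first by rewrite ltrDl invr_gt0.
Qed.

(** * Finite clusters of light edges *)

Section first_passage.
Variables (R : realType) (d : nat) (dT : measure_display) (T : measurableType dT).
Variables (P : probability T R) (mu : probability R R) (tau : E d -> T -> R).
Hypothesis tau_meas : forall e, measurable_fun setT (tau e).
Hypothesis tau_ge0 : forall e om, 0 <= tau e om.
Hypothesis tau_indep : indep_RVs P tau.
Hypothesis tau_law : forall e (B : set R), measurable B -> P (tau e @^-1` B) = mu B.

Lemma preimage_le e a : tau e @^-1` [set` `]-oo, a]] = [set om | tau e om <= a].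
Proof. by apply/seteqP; split=> om /=; rewrite in_itv. Qed.

Lemma bernoulli_bond_le (a : R) :
  bernoulli_bond P (distF mu a) (fun e om => tau e om <= a).
Proof.
split=> [e||e].
- by rewrite -preimage_le -[X in measurable X]setTI; exact: tau_meas.
- rewrite (_ : (fun e => _) = (fun e => tau e @^-1` [set` `]-oo, a]])).
    by apply: tau_indep.
  by apply/funext => e; rewrite preimage_le.
- by rewrite -preimage_le tau_law // /distF probability_fine.
Qed.

(** The edge is an argument because non-negativity is known for the weights and reaches [mu] through
    the law of one of them. *)
Lemma lbound_distF : E d -> lbound [set a : R | 0 < distF mu a] 0.
Proof.
move=> e a /=; rewrite leNgt; apply: contraL => a0; rewrite -leNgt.
rewrite /distF -(tau_law e) // preimage_le.
rewrite (_ : [set om | _] = set0) ?measure0 //.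
by rewrite -subset0 => om /=; rewrite leNgt (lt_le_trans a0).
Qed.

Lemma finite_clusters_ae :
  E d -> (ess_inf mu = 0 -> distF mu (ess_inf mu) < p_c R d) ->
  exists2 delta : R, 0 < delta &
  P.-negligible [set om | ~ forall v, finite_set (open_cluster (fun e => tau e om <= delta) v)].
Proof.
move=> e0 h0; have lb := lbound_distF e0.
have r0 : 0 <= ess_inf mu.
  have [A0|/set0P A0] := eqVneq [set a : R | 0 < distF mu a] set0.
    by rewrite /ess_inf A0 inf0.
  exact: lb_le_inf.
have [rpos|] := ltP 0 (ess_inf mu); last first.
  move=> r0'; have r00 : ess_inf mu = 0 by apply/le_anti; rewrite r0 r0'.
  have [delta dpos dlt] := distF_right_lt (h0 r00); rewrite r00 in dpos.
  exists delta => //; apply: finite_clusters_subcritical dlt _.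
    exact: bernoulli_bond_le.
  by rewrite /distF fine_ge0.
(* Almost surely no weight is at most half the infimum, and then every cluster is its starting
   vertex alone. *)
exists (ess_inf mu / 2); first by rewrite divr_gt0.
apply: (@negligibleS _ _ _ _
  (\bigcup_n (if unpickle n is Some e then [set om | tau e om <= ess_inf mu / 2] else set0))).
  move=> om /= nfin; apply: contrapT => h; apply: nfin => v.
  apply: (@sub_finite_set _ _ [set v]); last exact: finite_set1.
  move=> u [_ [/nn_pathP [p [-> <- vp]] pL]] /=.
  case: p vp pL => [//|y p] /= /andP [/edge_of_adj [e ve] _].
  move=> /(_ e); rewrite edges_cons ve mem_head => /(_ isT) le.
  by case: h; exists (pickle e) => //; rewrite pickleK.
apply: negligible_bigcup => n; case: (unpickle n) => [e|]; last exact: negligible_set0.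
have me : measurable [set om | tau e om <= ess_inf mu / 2].
  by rewrite -preimage_le -[X in measurable X]setTI; exact: tau_meas.
apply/negligibleP => //; rewrite -preimage_le.
transitivity (mu [set` `]-oo, ess_inf mu / 2]]); first exact: tau_law.
apply/eqP; rewrite eq_le measure_ge0 andbT -(mu_lt_ess_inf (ex_intro _ 0 lb)).
apply: le_measure; rewrite ?inE // => u /=; rewrite !in_itv /= => /le_lt_trans; apply.
by rewrite ltr_pdivrMr // ltr_pMr // ltr1n.
Qed.

(** * Lower bound for the expectation of [nu] *)

Lemma measurable_between e (a b : R) : measurable [set om | a <= tau e om <= b].
Proof.
rewrite [X in measurable X](_ : _ = tau e @^-1` [set` `[a, b]]).
  by rewrite -[X in measurable X]setTI; exact: tau_meas.
by apply/seteqP; split=> om /=; rewrite in_itv.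
Qed.

Variables (rk : seq (V d) -> nat) (x : V d).
Hypothesis rk_inj : injective rk.

Lemma first_geodesic_uniq om s s' : first_geodesic rk tau om x s ->
  first_geodesic rk tau om x s' -> s = s'.
Proof.
move=> [g1 m1] [g2 m2]; apply: rk_inj; apply/eqP.
by rewrite eqn_leq m1 // m2.
Qed.

(** The first geodesic is unique, so [xget] picks the intended ratio; as a sum of indicators it can
    be integrated edge by edge. *)
Lemma nuE a b om s : first_geodesic rk tau om x s ->
  nu rk tau x a b om = \sum_(e <- edges s)
     (size (edges s))%:R^-1 * \1_[set om | a <= tau e om <= b] om.
Proof.
move=> gs; rewrite /nu.
rewrite (@xget_subset1 _ 0 _ ((count (fun e => a <= tau e om <= b) (edges s))%:R
        / (size (edges s))%:R)).
- rewrite -mulr_sumr mulrC; congr (_ * _).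
  rewrite -sum1_count natr_sum big_mkcond /=; apply: eq_bigr => e _.
  rewrite indicE; case: ifPn => [h|h]; first by rewrite mem_set.
  by rewrite memNset //=; exact/negP.
- by exists s.
- move=> _ _ [s1 [g1 ->]] [s2 [g2 ->]].
  by rewrite (first_geodesic_uniq g1 g2).
Qed.

Lemma nu_ge0 a b om : 0 <= nu rk tau x a b om.
Proof.
by rewrite /nu; case: xgetP => [v _ [s [_ ->]]|//]; rewrite divr_ge0.
Qed.

Lemma nu_eq0 a b om : (forall s, ~ first_geodesic rk tau om x s) ->
  nu rk tau x a b om = 0.
Proof. by move=> h; rewrite /nu xgetPN // => v [s [/h]]. Qed.

Hypothesis x_neq0 : x != 0.

Lemma size_edges_gt0 s : sa_path 0 x s -> (0 < size (edges s))%N.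
Proof.
move=> [/nn_pathP [p [-> lp vp]] _]; rewrite size_edges //.
by case: p lp {vp} => [/= x0|//]; case/eqP: x_neq0.
Qed.

Let r := ess_inf mu.
Hypothesis mu_r : mu [set` `]-oo, r[] = 0%E.

(** Weights are almost surely at least [r], so the two-sided condition may be replaced by a
    decreasing event, as association requires. *)
Lemma probability_setI_between e b A : measurable A ->
  P (A `&` [set om | r <= tau e om <= b]) = P (A `&` [set om | tau e om <= b]).
Proof.
move=> mA.
have -> : [set om | r <= tau e om <= b] = [set om | tau e om <= b] `&` [set om | r <= tau e om].
  by apply/seteqP; split=> om /=; rewrite andbC => /andP.
have mrE : ~` [set om | r <= tau e om] = tau e @^-1` [set` `]-oo, r[].
  by apply/seteqP; split=> om /=; rewrite in_itv /= ltNge => /negP.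
rewrite setIA probability_setI_full //.
- apply: measurableI => //.
  by rewrite -preimage_le -[X in measurable X]setTI; exact: tau_meas.
- rewrite -[X in measurable X]setCK mrE; apply: measurableC.
  by rewrite -[X in measurable X]setTI; exact: tau_meas.
- by rewrite mrE tau_law.
Qed.

Lemma first_geodesic_between e b s : e \in edges s ->
  (P [set om | first_geodesic rk tau om x s] * mu [set` `[r, b]] <=
   P ([set om | first_geodesic rk tau om x s] `&` [set om | (r <= tau e om <= b)%R]))%E.
Proof.
move=> es; rewrite probability_setI_between; last exact: measurable_first_geodesic.
have -> : mu [set` `[r, b]] = P [set om | tau e om <= b].
  have := @probability_setI_between e b setT measurableT; rewrite !setTI => <-.
  by rewrite -(tau_law e).
exact: first_geodesic_le_association.
Qed.

Lemma integral_nu_first_geodesic b s :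
  (P [set om | first_geodesic rk tau om x s] * mu [set` `[r, b]] <=
   \int[P]_(om in [set om | first_geodesic rk tau om x s]) (nu rk tau x r b om)%:E)%E.
Proof.
set G := [set om | _]; have mG : measurable G by exact: measurable_first_geodesic.
have [sas|nsas] := pselect (sa_path 0 x s); last first.
  have -> : G = set0 by rewrite -subset0 => om [[]].
  by rewrite measure0 mul0e integral_set0.
set k := size (edges s); have k0 : (0 < k)%N by exact: size_edges_gt0.
have k0' : (k%:R : R) != 0 by rewrite pnatr_eq0 -lt0n.
rewrite (eq_integral (fun om => \sum_(e <- edges s)
   (k%:R^-1)%:E * (\1_[set om | (r <= tau e om <= b)%R] om)%:E)%E); last first.
  move=> om; rewrite inE => gs; rewrite (nuE _ _ gs) -sumEFin.
  by apply: eq_bigr => e _; rewrite EFinM.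
have mI e : measurable_fun G (fun om => (\1_[set om | (r <= tau e om <= b)%R] om : R)%:E).
  by apply/measurable_EFinP/measurable_indic; exact: measurable_between.
rewrite ge0_integral_sum //; last by move=> e; exact: measurable_funeM.
(* The bound is cut into [k] equal shares, one per edge of [s], to be compared term by term. *)
have -> : (P G * mu [set` `[r, b]])%E =
    (\sum_(e <- edges s) ((k%:R^-1)%:E * (P G * mu [set` `[r, b]])))%E.
  rewrite -[P G]probability_fine // -[mu _]probability_fine //.
  under eq_bigr do rewrite -!EFinM.
  rewrite sumEFin -EFinM; congr EFin.
  by rewrite big_const_seq count_predT iter_addr_0 -/k -[RHS]mulr_natl mulVKf.
rewrite big_seq [leRHS]big_seq; apply: lee_sum => e es.
rewrite ge0_integralZl_EFin ?invr_ge0 //.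
apply: lee_wpmul2l; first by rewrite lee_fin invr_ge0.
rewrite integral_indic //; last exact: measurable_between.
by rewrite setIC; exact: first_geodesic_between.
Qed.

(** The values of the first geodesic partition the space up to a null set, and the bounds on the
    pieces add up. *)
Lemma integral_nu_ge b :
  P.-negligible [set om | forall s, ~ first_geodesic rk tau om x s] ->
  (mu [set` `[r, b]] <= \int[P]_om (nu rk tau x r b om)%:E)%E.
Proof.
move=> neg.
(* With [pickle_inv] each list comes from exactly one code, which keeps the events [G n]
   disjoint. *)
pose G n := if pickle_inv n is Some s then [set om | first_geodesic rk tau om x s] else set0.
have mG n : measurable (G n).
  by rewrite /G; case: pickle_inv => [s|//]; exact: measurable_first_geodesic.
have UG om : (\bigcup_n G n) om <-> exists s, first_geodesic rk tau om x s.
  split=> [[n _]|[s gs]]; last by exists (pickle s) => //; rewrite /G pickleK_inv.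
  by rewrite /G; case: pickle_inv => [s gs|//]; exists s.
have tG : trivIset setT G.
  move=> m n _ _ [om []]; rewrite /G.
  have := @pickle_invK (seq (V d)) m; have := @pickle_invK (seq (V d)) n.
  case: pickle_inv => [s|//]; case: pickle_inv => [s'|//] /= <- <- g1 g2.
  by rewrite (first_geodesic_uniq g1 g2).
have mU : measurable (\bigcup_n G n) by exact: bigcupT_measurable.
have PU : P (\bigcup_n G n) = 1%E.
  rewrite -[RHS]/(1%:E) -[1 in RHS]subr0; apply: probability_setC_eq => //.
  apply/negligibleP; first exact: measurableC.
  by apply: negligibleS neg => om /= nU s gs; apply: nU; apply/UG; exists s.
(* Off the union [nu] takes its default value 0, so restricting the integral changes nothing. *)
have -> : (\int[P]_om (nu rk tau x r b om)%:E =
    \int[P]_(om in \bigcup_n G n) (nu rk tau x r b om)%:E)%E.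
  rewrite [RHS]integral_mkcond; apply: eq_integral => om _; rewrite patchE.
  case: ifPn => //; rewrite notin_setE => nU; rewrite nu_eq0 // => s gs.
  by apply: nU; apply/UG; exists s.
rewrite ge0_integral_bigcup //; last 2 first.
- apply/measurable_fun_bigcup => // n; rewrite /G; case: pickle_inv => [s|]; last first.
    exact: measurable_fun_set0.
  apply/measurable_EFinP; apply: eq_measurable_fun.
    by move=> om; rewrite inE => gs; exact/esym/(nuE _ _ gs).
  apply: measurable_sum => e; apply: measurable_funM => //.
  by apply: measurable_indic; exact: measurable_between.
- by move=> om _; rewrite lee_fin nu_ge0.
have -> : mu [set` `[r, b]] = (\sum_(n <oo) (fine (mu [set` `[r, b]]))%:E * P (G n))%E.
  have PS : (\sum_(n <oo) P (G n) = 1)%E.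
    by rewrite -PU; apply/esym; exact: measure_semi_bigcup.
  by rewrite nneseriesZl // PS mule1 probability_fine.
apply: lee_nneseries => [n _ _|n _].
  by rewrite mule_ge0 // probability_fine.
rewrite probability_fine // /G; case: pickle_inv => [s|]; last first.
  by rewrite measure0 mule0 integral_set0.
by rewrite muleC; exact: integral_nu_first_geodesic.
Qed.

End first_passage.

Theorem theorem2p5 (R : realType) (d : nat) (hd : (2 <= d)%N)
  (dT : measure_display) (T : measurableType dT) (P : probability T R)
  (mu : probability R R) (tau : E d -> T -> R)
  (tau_meas : forall e, measurable_fun setT (tau e))
  (tau_ge0 : forall e om, 0 <= tau e om)
  (tau_indep : indep_RVs P tau)
  (tau_law : forall e (B : set R), measurable B -> P (tau e @^-1` B) = mu B)
  (h0 : ess_inf mu = 0 -> distF mu (ess_inf mu) < p_c R d)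
  (hpos : 0 < ess_inf mu -> distF mu (ess_inf mu) < vec_p_c R d)
  (rk : seq (V d) -> nat) (rk_inj : injective rk) :
  exists C : R, 0 < C /\
    forall eps : R, 0 <= eps ->
      exists N : nat, forall x : V d, (N <= l1 x)%N ->
        (C%:E * mu [set` `[ess_inf mu, (ess_inf mu + eps)%R]]
          <= \int[P]_om (nu rk tau x (ess_inf mu) (ess_inf mu + eps)%R om)%:E)%E.
Proof.
(* [N = 1] excludes the origin, where the path has no edges and the ratio is 0. *)
exists 1; split=> // eps _; exists 1%N => x lx; rewrite mul1e.
have e0 : E d := (0, Ordinal (ltnW hd)).
have x0 : x != 0.
  apply: contraTneq lx => ->; rewrite -ltnNge ltnS /l1 big1 // => i _.
  by rewrite mxE.
have lb := lbound_distF tau_ge0 tau_law e0.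
apply: integral_nu_ge => //; first exact: mu_lt_ess_inf (ex_intro _ 0 lb).
have [delta dpos] := finite_clusters_ae tau_meas tau_ge0 tau_indep tau_law e0 h0.
apply: negligibleS => om /= ng fin.
have [s gs] := @exists_first_geodesic R d T rk tau om x delta (tau_ge0^~ om) dpos fin.
exact: (ng s).
Qed.
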